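(* Let $\mathcal{G}$ be a hereditary graph class (closed under taking induced subgraphs) and let $k\ge 2$. Suppose that the $k$-dimensional Weisfeiler–Leman algorithm distinguishes every two non-isomorphic $2$-connected vertex-colored graphs $(H,\lambda)$ and $(H',\lambda')$ with $H,H'\in\mathcal{G}$. Then the $k$-dimensional Weisfeiler–Leman algorithm distinguishes every two non-isomorphic graphs in $\mathcal{G}$.
   Context: Graphs are finite, simple and undirected; uncolored graphs are treated as monochromatic. A vertex-colored graph is a pair $(G,\lambda)$ with $\lambda\colon V(G)\to\mathcal{C}$. A graph is $k$-connected if it has more than $k$ vertices and removing any fewer than $k$ vertices leaves it connected. For $k\ge2$, the $k$-dimensional Weisfeiler–Leman (WL) algorithm computes a coloring of $V(G)^k$: the initial color of $(v_1,\dots,v_k)$ consists of $\lambda(v_1)$ together with the isomorphism type of the ordered induced subgraph on $(v_1,\dots,v_k)$ (which entries are equal and which adjacent); in each round the new color of a tuple $\bar v$ is the pair of its old color and the multiset, over $w\in V(G)$, of the $k$-tuples whose $i$-th component is the old color of the tuple obtained from $\bar v$ by replacing its $i$-th entry with $w$. Iteration stops when the partition is stable, giving $\chi^k_G$; colors are canonical and comparable across graphs. The algorithm distinguishes two (colored) graphs if some color is attained by different numbers of $k$-tuples in the two graphs. *)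

(* Defs.v *)
From mathcomp Require Import all_boot.
Set Implicit Arguments. Unset Strict Implicit. Unset Printing Implicit Defensive.

Record graph := Graph {
  vert :> finType;
  adj : rel vert;
  adj_sym : symmetric adj;
  adj_irr : irreflexive adj }.

Record cgraph := CGraph {
  cbase :> graph;
  col : vert cbase -> nat }.

Definition mono (G : graph) : cgraph := @CGraph G (fun _ => 0).

Section Induced.
Variables (G : graph) (S : {set vert G}).
Definition ind_vert : finType := {x : vert G | x \in S}.
Definition ind_adj : rel ind_vert := fun x y => adj (val x) (val y).
Lemma ind_adj_sym : symmetric ind_adj.
Proof. by move=> x y; rewrite /ind_adj adj_sym. Qed.
Lemma ind_adj_irr : irreflexive ind_adj.
Proof. by move=> x; rewrite /ind_adj adj_irr. Qed.
Definition induced : graph := @Graph ind_vert ind_adj ind_adj_sym ind_adj_irr.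
End Induced.

Definition iso (G H : graph) : Prop :=
  exists f : vert G -> vert H, bijective f /\
    forall x y : vert G, adj x y = adj (f x) (f y).

Definition ciso (G H : cgraph) : Prop :=
  exists f : vert (cbase G) -> vert (cbase H), bijective f /\
    (forall x y : vert (cbase G), adj x y = adj (f x) (f y)) /\
    (forall x : vert (cbase G), col x = col (f x)).

Definition graph_class (cls : graph -> Prop) : Prop :=
  forall G H, iso G H -> cls G -> cls H.

Definition hereditary (cls : graph -> Prop) : Prop :=
  forall (G : graph) (S : {set vert G}), cls G -> cls (induced S).

Definition connected (G : graph) : Prop :=
  forall x y : vert G, connect (@adj G) x y.

Definition kconnected (k : nat) (G : graph) : Prop :=
  k < #|vert G| /\
  forall S : {set vert G}, #|S| < k -> connected (induced (~: S)).

(* Colors are canonical trees (GenTree.tree nat), comparable across graphs.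
   Multisets are represented canonically by sorting w.r.t. the injective
   encoding pickle. *)
Definition wlcolor := GenTree.tree nat.

Definition ms_le (a b : wlcolor) : bool := (pickle a <= pickle b)%N.

Section WL.
Variables (k : nat) (G : cgraph).

Definition ktuple := {ffun 'I_k -> vert (cbase G)}.

Definition upd (v : ktuple) (i : 'I_k) (w : vert (cbase G)) : ktuple :=
  [ffun j => if j == i then w else v j].

(* initial color: color of v_1 together with the atomic type of the ordered
   tuple (which entries are equal, which adjacent) *)
Definition wl_init (v : ktuple) : wlcolor :=
  GenTree.Node 0
    [:: GenTree.Node 0 [seq GenTree.Leaf (col (v i)) | i <- enum 'I_k & val i == 0%N];
        GenTree.Node 0 [seq GenTree.Leaf (nat_of_bool (v i == v j)
                                         + 2 * nat_of_bool (adj (v i) (v j)))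
                       | i <- enum 'I_k, j <- enum 'I_k]].

Fixpoint wl (r : nat) (v : ktuple) : wlcolor :=
  match r with
  | 0 => wl_init v
  | r'.+1 =>
      GenTree.Node 1
        [:: wl r' v;
            GenTree.Node 2
              (sort ms_le
                 [seq GenTree.Node 3 [seq wl r' (upd v i w) | i <- enum 'I_k]
                 | w <- enum (vert (cbase G))])]
  end.

Definition wl_count (r : nat) (c : wlcolor) : nat := #|[pred v : ktuple | wl r v == c]|.
End WL.

(* k-WL distinguishes G and H: at some round (equivalently at the stable
   coloring) some color is attained by different numbers of k-tuples. *)
Definition wl_distinguishes (k : nat) (G H : cgraph) : Prop :=
  exists (r : nat) (c : wlcolor), wl_count k G r c <> wl_count k H r c.

(* Main.v *)
Require Import Defs.
From mathcomp Require Import all_boot.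
From Stdlib Require Import Classical.
Set Implicit Arguments. Unset Strict Implicit. Unset Printing Implicit Defensive.

(** By induction on the size, indistinguishable colored graphs of the class are
    isomorphic. Separation by a vertex is determined by the colors of pairs, because
    the number of walks from [x] to [y] avoiding [c] is a difference of two numbers
    determined by the colors of [(x, y)], [(x, c)] and [(c, y)]. Hence cut vertices
    and blocks are visible to WL. Delete the noncut vertices of all blocks with at
    most one cut vertex (isolated vertices, 2-connected components, leaf blocks) and
    color the remaining vertices by their WL color; the smaller graphs are still
    indistinguishable, hence isomorphic. The blocks that were cut off are isomorphic
    as soon as two of their noncut vertices have the same WL color (by hypothesis if
    they are 2-connected, trivially if they have at most two vertices), and counting
    colors around each cut vertex allows to glue them back. *)

(** * WL equivalence as a bisimulation *)

(** The permutation of positions behind [perm_eq] becomes a map between the enumerated elements.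
    Later this extracts a matching of vertices from equal WL colors. *)
Lemma perm_map_bij (T T' : finType) (C : eqType) (g : T -> C) (g' : T' -> C) :
  perm_eq (map g (enum T)) (map g' (enum T')) ->
  exists2 f : T -> T', bijective f & forall x, g' (f x) = g x.
Proof.
move=> Hp; have cTT' : #|T| = #|T'|.
  by have := perm_size Hp; rewrite !size_map !cardE !enumT.
have [/eqP T0 | ] := boolP (#|T| == 0).
  have nT (x : T) : False by have := fintype0 x T0.
  have nT' (x : T') : False by apply: (fintype0 x); rewrite -cTT'.
  exists (fun x => False_rect _ (nT x)) => [|x]; last by case: (nT x).
  by exists (fun x => False_rect _ (nT' x)) => x; [case: (nT x)|case: (nT' x)].
rewrite cTT' -lt0n => /card_gt0P[y0 _].
have /(perm_iotaP (g' y0))[Is pIs eIs] := Hp.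
have szI : size Is = #|T'| by rewrite (perm_size pIs) size_iota size_map -cardE.
have uI : uniq Is by rewrite (perm_uniq pIs) iota_uniq.
have idx x : index x (enum T) < size Is.
  by rewrite szI -cTT' cardE index_mem mem_enum.
have ltI x : nth 0 Is (index x (enum T)) < size (enum T').
  have: nth 0 Is (index x (enum T)) \in Is by rewrite mem_nth.
  by rewrite (perm_mem pIs) mem_iota size_map.
pose f x := nth y0 (enum T') (nth 0 Is (index x (enum T))).
exists f => [|x].
  apply: inj_card_bij; last by rewrite cTT'.
  move=> x y /eqP; rewrite /f nth_uniq ?enum_uniq // nth_uniq // => /eqP.
  by move/(congr1 (nth y (enum T))); rewrite !nth_index ?mem_enum.
have lx : index x (enum T) < size (enum T) by rewrite index_mem mem_enum.
rewrite /f -(nth_map y0 (g' y0)) // -(nth_map 0 (g' y0)) // -eIs.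
by rewrite (nth_map x) // nth_index // mem_enum.
Qed.

Lemma bij_perm_map (T T' : finType) (C : eqType) (g : T -> C) (g' : T' -> C)
    (f : T -> T') :
  bijective f -> (forall x, g' (f x) = g x) ->
  perm_eq (map g (enum T)) (map g' (enum T')).
Proof.
move=> bf Hf.
have -> : map g (enum T) = map g' (map f (enum T)).
  by rewrite -map_comp; apply: eq_map => x /=.
apply: perm_map; apply: uniq_perm; rewrite ?enum_uniq //.
  by rewrite map_inj_uniq ?enum_uniq //; exact: bij_inj.
move=> y; rewrite mem_enum; case: bf => h _ hK.
by apply/mapP; exists (h y); rewrite ?mem_enum ?hK.
Qed.

Lemma bij_card_set (T T' : finType) (f : T -> T') (A : {set T}) (B : {set T'}) :
  bijective f -> (forall x, (x \in A) = (f x \in B)) -> #|A| = #|B|.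
Proof.
move=> bf Hf; rewrite -(card_imset _ (bij_inj bf)); apply: eq_card => y.
case: (bf) => h hK Kh; apply/imsetP/idP => [[x Ax ->]|By]; first by rewrite -Hf.
by exists (h y); rewrite ?Kh // Hf Kh.
Qed.

Lemma bij_sub (T T' : finType) (S : {set T}) (S' : {set T'}) (f : T -> T') :
  bijective f -> (forall x, (x \in S) = (f x \in S')) ->
  exists2 g : {x : T | x \in S} -> {x : T' | x \in S'},
    bijective g & forall x, val (g x) = f (val x).
Proof.
move=> [h hK Kh] Hf.
have Pg (x : {x : T | x \in S}) : f (val x) \in S' by rewrite -Hf (valP x).
have Ph (x : {x : T' | x \in S'}) : h (val x) \in S by rewrite Hf Kh (valP x).
exists (fun x => exist _ (f (val x)) (Pg x)) => //.
by exists (fun x => exist _ (h (val x)) (Ph x)) => x; apply: val_inj => /=.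
Qed.

Lemma ms_le_total : total ms_le.
Proof. by move=> a b; apply: leq_total. Qed.
Lemma ms_le_trans : transitive ms_le.
Proof. by move=> a b c; apply: leq_trans. Qed.
Lemma ms_le_anti : antisymmetric ms_le.
Proof. by move=> a b; rewrite -eqn_leq => /eqP; apply: (pcan_inj pickleK). Qed.

Definition wl_equiv (k : nat) (G G' : cgraph) (v : ktuple k G) (v' : ktuple k G') :=
  forall r, wl r v = wl r v'.

(** Positions from which Duplicator wins the bijective pebble game. One [f] serves all [i], since a
    WL round records all replacements by the same [w] together. *)
Definition wl_bisim (k : nat) (G G' : cgraph)
    (P : ktuple k G -> ktuple k G' -> Prop) :=
  forall v v', P v v' ->
  [/\ forall i, col (v i) = col (v' i),
      forall i j, (v i == v j) = (v' i == v' j) /\ adj (v i) (v j) = adj (v' i) (v' j)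
    & exists2 f : vert G -> vert G', bijective f &
      forall i w, P (upd v i w) (upd v' i (f w))].

Section Equiv.
Variables (k : nat).

Lemma wl_equiv_sym (G G' : cgraph) (v : ktuple k G) (v' : ktuple k G') :
  wl_equiv v v' -> wl_equiv v' v.
Proof. by move=> H r. Qed.

(** Induction on the round: [f] matches the two multisets of colors, and equal multisets have the
    same sorted list because [ms_le] is a total order. *)
Lemma bisim_equiv (G G' : cgraph) (P : ktuple k G -> ktuple k G' -> Prop) :
  wl_bisim P -> forall v v', P v v' -> wl_equiv v v'.
Proof.
move=> HP v v' Pv r; elim: r v v' Pv => [|r IH] v v' /[dup] Pv /HP[Hc Ha [f bf Hf]] /=.
  rewrite /wl_init; congr GenTree.Node; congr [:: _; _].
    by congr GenTree.Node; apply: eq_map => i; rewrite Hc.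
  congr GenTree.Node; congr flatten; apply: eq_map => i; apply: eq_map => j.
  by have [-> ->] := Ha i j.
rewrite (IH v v') //; congr GenTree.Node; congr [:: _; _]; congr GenTree.Node.
apply/perm_sortP; [exact: ms_le_total|exact: ms_le_trans|exact: ms_le_anti|].
apply: (bij_perm_map bf) => w; congr GenTree.Node; apply: eq_map => i.
by apply/esym/IH/Hf.
Qed.

Lemma wl_mono (G G' : cgraph) (v : ktuple k G) (v' : ktuple k G') r s :
  r <= s -> wl s v = wl s v' -> wl r v = wl r v'.
Proof.
move=> /subnKC <-; elim: (s - r) => [|d IH]; first by rewrite addn0.
by rewrite addnS => -[/IH].
Qed.

(** Every inequivalent pair of tuples is separated at some round; as colors only get finer, the
    maximum over the finitely many pairs works for all. *)
Lemma stable_round (G G' : cgraph) :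
  exists R, forall (v : ktuple k G) (v' : ktuple k G'),
    wl R v = wl R v' -> wl_equiv v v'.
Proof.
have H (p : ktuple k G * ktuple k G') :
    exists r, wl r p.1 = wl r p.2 -> wl_equiv p.1 p.2.
  have [Hp|] := classic (wl_equiv p.1 p.2); first by exists 0.
  by move/not_all_ex_not=> [r Hr]; exists r => /Hr.
have [R HR] := fin_all_exists H.
exists (\max_p R p) => v v' Hv; apply: (HR (v, v')).
by apply: wl_mono Hv; apply: (leq_bigmax (v, v')).
Qed.

(** Equal colors at round [R.+1] contain equal multisets of colors of round [R], which yields [f];
    stability of [R] extends the equalities to all rounds. *)
Lemma wl_equiv_move (G G' : cgraph) (v : ktuple k G) (v' : ktuple k G') :
  wl_equiv v v' ->
  exists2 f : vert G -> vert G', bijective f &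
    forall i w, wl_equiv (upd v i w) (upd v' i (f w)).
Proof.
move=> Hv; have [R HR] := stable_round G G'.
have [_ /(perm_sortP ms_le_total ms_le_trans ms_le_anti)] := Hv R.+1.
move=> /perm_map_bij[f bf Hf].
exists f => // i w; apply: HR; have [/eq_in_map Hw] := Hf w.
by rewrite Hw // mem_enum.
Qed.

Lemma wl_equiv_rel (G G' : cgraph) (v : ktuple k G) (v' : ktuple k G') i j :
  wl_equiv v v' ->
  (v i == v j) = (v' i == v' j) /\ adj (v i) (v j) = adj (v' i) (v' j).
Proof.
move=> /(_ 0) [_] /eqP.
(* The nested list is rewritten as one map over pairs of indices, so that its entry at [(i, j)] can
   be compared. *)
pose g (u : rel 'I_k) (w : rel 'I_k) (p : 'I_k * 'I_k) :=
  GenTree.Leaf (nat_of_bool (u p.1 p.2) + 2 * nat_of_bool (w p.1 p.2)).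
have flat (u w : rel 'I_k) :
  [seq GenTree.Leaf (u i0 j0 + 2 * w i0 j0) | i0 <- enum 'I_k, j0 <- enum 'I_k]
  = map (g u w) [seq (i, j) | i <- enum 'I_k, j <- enum 'I_k].
  by rewrite map_allpairs.
rewrite (flat (fun i j => v i == v j) (fun i j => adj (v i) (v j))).
rewrite (flat (fun i j => v' i == v' j) (fun i j => adj (v' i) (v' j))).
move=> /eqP/eq_in_map/(_ (i, j)).
rewrite allpairs_f ?mem_enum // => /(_ isT) [].
by case: (v i == v j); case: (v' i == v' j); case: (adj _ _); case: (adj _ _).
Qed.

End Equiv.

(** * Cut vertices and leaf blocks *)

Lemma connect_map (T U : finType) (e : rel T) (e' : rel U) (p : T -> U) :
  (forall x y, e x y -> connect e' (p x) (p y)) ->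
  forall x y, connect e x y -> connect e' (p x) (p y).
Proof.
move=> He x y /connectP[s]; elim: s x => [|z s IH] x /= => [_ ->|]; first exact: connect0.
by case/andP=> /He xz /IH H /H; apply: connect_trans.
Qed.

Section Blocks.
Variable G : graph.
Implicit Types (x y z u v w c d : vert G).

Definition adj_off w : rel (vert G) := fun x y => [&& adj x y, x != w & y != w].
(** The two inequalities rule out the empty path at [w]. *)
Definition linked_off w x y := [&& x != w, y != w & connect (adj_off w) x y].
Definition cutv c := [exists u, exists v, [&& adj c u, adj c v & ~~ linked_off c u v]].
(* For a noncut vertex [z] this is the block of [z]: two vertices lie in a common
   block iff they are connected and no third vertex separates them. *)
Definition blk z : {set vert G} :=
  [set y | connect (@adj G) z y &&
           [forall w, (w != z) ==> (w != y) ==> linked_off w z y]].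
Definition leaf z := ~~ cutv z &&
  [forall c in blk z, forall d in blk z, cutv c ==> cutv d ==> (c == d)].

Lemma adj_connect_sym : connect_sym (@adj G).
Proof. exact/sym_connect_sym/adj_sym. Qed.

Lemma linked_off_sym w x y : linked_off w x y = linked_off w y x.
Proof.
rewrite /linked_off andbCA; congr [&& _, _ & _]; apply: sym_connect_sym => a b.
by rewrite /adj_off adj_sym [(a != w) && _]andbC.
Qed.

Lemma linked_off_trans w y x z : linked_off w x y -> linked_off w y z -> linked_off w x z.
Proof.
move=> /and3P[xw _ xy] /and3P[_ zw yz]; rewrite /linked_off xw zw.
exact: connect_trans yz.
Qed.

Lemma linked_off_refl w x : x != w -> linked_off w x x.
Proof. by move=> xw; rewrite /linked_off xw connect0. Qed.

Lemma linked_off_adj w x y : adj x y -> x != w -> y != w -> linked_off w x y.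
Proof. by move=> xy xw yw; rewrite /linked_off xw yw connect1 // /adj_off xy xw. Qed.

(** A path from [x] that avoids [w] stays in the component of [x] in the graph without [w]; since
    [c] is not in it, the path avoids [c] too. *)
Lemma linked_off_change w c x y :
  linked_off w x y -> ~~ linked_off w x c -> linked_off c x y.
Proof.
move=> /and3P[xw _ /connectP[s]].
elim: s x xw => [|a s IH] x xw /= => [_ ->|].
  move=> nxc; apply: linked_off_refl; apply: contraNneq nxc => <-.
  exact: linked_off_refl.
case/andP=> /and3P[xa _ aw] sP yE nxc.
have xa_w : linked_off w x a by apply: linked_off_adj.
have nac : ~~ linked_off w a c by apply: contra nxc; apply: linked_off_trans.
apply: linked_off_trans (IH _ aw sP yE nac).
apply: linked_off_adj => //.
  by apply: contraNneq nxc => <-; apply: linked_off_refl.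
by apply: contraNneq nac => <-; apply: linked_off_refl.
Qed.

(** The vertex just before the first visit of [z] on a path from [x] to [z] serves as [u]. *)
Lemma connect_first_step z x : connect (@adj G) z x -> x != z ->
  exists2 u, adj z u & linked_off z u x.
Proof.
rewrite adj_connect_sym => /connectP[s]; elim: s x => [|a s IH] x /=.
  by move=> _ ->; rewrite eqxx.
case/andP=> xa sP zE xz; have [az|az] := eqVneq a z.
  by exists x; rewrite ?linked_off_refl // adj_sym -az.
have [u zu ua] := IH a sP zE az; exists u => //.
by apply: linked_off_trans ua _; apply: linked_off_adj => //; rewrite adj_sym.
Qed.

(** Both vertices reach neighbors of [z] without passing through [z], and these neighbors are linked
    because [z] is not a cut vertex. *)
Lemma noncut_linked z x y : ~~ cutv z -> connect (@adj G) z x -> connect (@adj G) z y ->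
  x != z -> y != z -> linked_off z x y.
Proof.
move=> ncz zx zy xz yz; have [u zu ux] := connect_first_step zx xz.
have [v zv vy] := connect_first_step zy yz.
rewrite linked_off_sym in ux; apply: linked_off_trans ux _.
apply: linked_off_trans vy.
apply: contraR ncz => uv; apply/existsP; exists u; apply/existsP; exists v.
by rewrite zu zv.
Qed.

Lemma mem_blkP z y :
  reflect (connect (@adj G) z y /\ forall w, w != z -> w != y -> linked_off w z y)
          (y \in blk z).
Proof.
rewrite inE; apply: (iffP andP) => -[zy H]; split=> //.
  by move=> w wz wy; move/forallP/(_ w)/implyP/(_ wz)/implyP: H; apply.
by apply/forallP => w; apply/implyP=> wz; apply/implyP; apply: H.
Qed.

Lemma blk_refl z : z \in blk z.
Proof.
by apply/mem_blkP; split=> [|w wz _]; rewrite ?connect0 ?linked_off_refl 1?eq_sym.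
Qed.

Lemma blk_sym z y : (y \in blk z) = (z \in blk y).
Proof.
suff H a b : b \in blk a -> a \in blk b by apply/idP/idP; apply: H.
move/mem_blkP=> [ab H]; apply/mem_blkP; split; first by rewrite adj_connect_sym.
by move=> w wa wb; rewrite linked_off_sym H.
Qed.

Lemma adj_blk z y : adj z y -> y \in blk z.
Proof.
move=> zy; apply/mem_blkP; split=> [|w wz wy]; first exact: connect1.
by apply: linked_off_adj; rewrite // eq_sym.
Qed.

(** A vertex [w] other than [z] separates neither [x] nor [y] from [z], and [z] itself separates
    nothing, being no cut vertex. *)
Lemma blk_linked z w x y : ~~ cutv z -> x \in blk z -> y \in blk z ->
  x != w -> y != w -> linked_off w x y.
Proof.
move=> ncz /mem_blkP[zx Hx] /mem_blkP[zy Hy] xw yw.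
have [wz|wz] := eqVneq w z; first by rewrite wz noncut_linked // -wz.
apply: (@linked_off_trans _ z); last by apply: Hy; rewrite // eq_sym.
by rewrite linked_off_sym; apply: Hx; rewrite // eq_sym.
Qed.

Lemma noncut_blk z y : ~~ cutv z -> ~~ cutv y -> y \in blk z -> blk y = blk z.
Proof.
suff H a b : ~~ cutv a -> b \in blk a -> blk a \subset blk b.
  by move=> cz cy zy; apply/eqP; rewrite eqEsubset !H // blk_sym.
move=> ca ba; apply/subsetP => x xa; apply/mem_blkP; split=> [|w wb wx].
  have [[ab _] [ax _]] := (mem_blkP _ _ ba, mem_blkP _ _ xa).
  by apply: connect_trans ax; rewrite adj_connect_sym.
by apply: (blk_linked ca); rewrite // eq_sym.
Qed.

Lemma leaf_noncut z : leaf z -> ~~ cutv z.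
Proof. by case/andP. Qed.

Lemma leaf_cut_uniq z c d : leaf z -> c \in blk z -> d \in blk z ->
  cutv c -> cutv d -> c = d.
Proof.
by case/andP=> _ /forall_inP/(_ c) H /H/forall_inP/(_ d) {}H /H
  /implyP{}H /H/implyP{}H /H/eqP.
Qed.

Lemma leaf_blk z y : leaf z -> y \in blk z -> ~~ cutv y -> leaf y /\ blk y = blk z.
Proof.
move=> lz yz cy; have E := noncut_blk (leaf_noncut lz) cy yz; split=> //.
by case/andP: lz => _; rewrite /leaf cy E.
Qed.

(* A component of [G - c], for a cut vertex [c], that has the least possible size
   contains no cut vertex. *)
Lemma leaf_exists x0 : exists z, leaf z.
Proof.
have [|nocut] := boolP [exists p : vert G * vert G, cutv p.1 && adj p.1 p.2]; last first.
  exists x0; have nc c : ~~ cutv c.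
    apply: contra nocut => cc; case/existsP: (cc) => u /existsP[v /and3P[cu _ _]].
    by apply/existsP; exists (c, u); rewrite cc.
  by rewrite /leaf nc; apply/forall_inP=> c _; apply/forall_inP=> d _; rewrite (negPf (nc c)).
case/existsP=> p0 Pp0.
pose D c u := [set v | linked_off c u v].
case: (@arg_minnP _ p0 (fun p => cutv p.1 && adj p.1 p.2) (fun p => #|D p.1 p.2|) Pp0)
  => -[c u] /andP[/= cc cu] Hmin.
have uc : u != c by apply: contraTneq cu => ->; rewrite adj_irr.
(* A cut vertex [d] in the minimal component would have a neighbor [a] that [d] separates from [c];
   the component of [a] without [d] lies inside the minimal one but misses [d]. *)
have ncD d : linked_off c u d -> ~~ cutv d.
  move=> ud; apply/negP => cd; have dc : d != c by case/and3P: ud.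
  have [a da nac] : exists2 a, adj d a & ~~ linked_off d a c.
    case/existsP: (cd) => a /existsP[b /and3P[da db nab]].
    have [ac|nac] := boolP (linked_off d a c); last by exists a.
    exists b => //; apply: contra nab => bc; apply: linked_off_trans ac _.
    by rewrite linked_off_sym.
  have ad : a != d by apply: contraTneq da => ->; rewrite adj_irr.
  have ac : a != c by apply: contraNneq nac => <-; apply: linked_off_refl.
  have /= := Hmin (d, a); rewrite cd da => /(_ isT); apply/negP; rewrite -ltnNge.
  apply: proper_card; apply/properP; split; last first.
    by exists d; rewrite !inE // /linked_off eqxx andbF.
  apply/subsetP => v; rewrite !inE => av.
  apply: linked_off_trans ud _; apply: (@linked_off_trans _ a).
    exact: linked_off_adj.
  exact: linked_off_change nac.
exists u; rewrite /leaf ncD ?linked_off_refl //=.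
have only d : d \in blk u -> cutv d -> d = c.
  move=> /mem_blkP[_ H] cd; apply/eqP; apply: contraTT cd => dc.
  by apply: ncD; apply: H; rewrite // eq_sym.
apply/forall_inP=> d du; apply/forall_inP=> e eu; apply/implyP=> cd.
by apply/implyP=> ce; rewrite (only d) // (only e).
Qed.

(** No single vertex separates two vertices of the block in [G]. The resulting path of [G] projects
    to a path of the block, as its excursions outside start and end at the unique cut vertex. *)
Lemma leaf_blk_2connected z : leaf z -> 2 < #|blk z| -> kconnected 2 (induced (blk z)).
Proof.
move=> lz cz; split; first by rewrite /= card_sig.
move=> S cS x y.
pose W := vert (induced (~: S)).
pose S0 := [set val p | p in S].
have inS0 p : (val p \in S0) = (p \in S).
  by rewrite mem_imset //; exact: val_inj.
pose e : rel (vert G) := fun a b => [&& adj a b, a \notin S0 & b \notin S0].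
have xyW (p : W) : val (val p) \notin S0 by rewrite inS0 -in_setC (valP p).
have exy : connect e (val (val x)) (val (val y)).
  have [xz yz] := (valP (val x), valP (val y)).
  have := cS; rewrite ltnS leq_eqVlt ltnS leqn0 cards_eq0 => /orP[/cards1P[w Sw]|/eqP S0E].
    have S0E : S0 = [set val w] by rewrite /S0 Sw imset_set1.
    have eE a b : e a b = adj_off (val w) a b by rewrite /e S0E !inE.
    rewrite (eq_connect eE).
    have /and3P[_ _ //] : linked_off (val w) (val (val x)) (val (val y)).
    apply: (blk_linked (leaf_noncut lz) xz yz).
      by have := xyW x; rewrite S0E inE.
    by have := xyW y; rewrite S0E inE.
  have eE a b : e a b = adj a b by rewrite /e /S0 S0E imset0 !inE !andbT.
  rewrite (eq_connect eE).
  have [[zx _] [zy _]] := (mem_blkP _ _ xz, mem_blkP _ _ yz).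
  by apply: connect_trans zy; rewrite adj_connect_sym.
(* [p] collapses everything outside [blk z] onto its only cut vertex. *)
pose d : W := odflt x [pick q : W | cutv (val (val q))].
pose p a : W := odflt d [pick q : W | val (val q) == a].
have pK (q : W) : p (val (val q)) = q.
  rewrite /p; case: pickP => [q' /eqP /val_inj /val_inj //|/(_ q)].
  by rewrite eqxx.
have pN a : a \notin blk z :\: S0 -> p a = d.
  move=> na; rewrite /p; case: pickP => //= q /eqP qa; case/negP: na.
  by rewrite in_setD -qa xyW; apply: (valP (val q)).
have pI a : a \in blk z :\: S0 -> exists q : W, a = val (val q).
  rewrite in_setD => /andP[aS az].
  pose a1 : vert (induced (blk z)) := exist _ a az.
  have a1S : a1 \in ~: S by rewrite inE -inS0.
  by exists (exist (fun b => b \in ~: S) a1 a1S).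
(* A noncut vertex of the block has all its neighbors in the block, so [a] is the cut vertex, and
   the [pick] in [d] finds it. *)
have step a b : adj a b -> a \in blk z :\: S0 -> b \notin S0 -> b \notin blk z :\: S0 ->
    p a = d.
  move=> ab aI bS bN; have [q aq] := pI a aI.
  have ca : cutv a.
    apply: contraR bN => nca; rewrite in_setD bS.
    have az : a \in blk z by move: aI; rewrite in_setD => /andP[].
    have [_ <-] := leaf_blk lz az nca; exact: adj_blk.
  rewrite aq pK /d; case: pickP => [q' cq'|/(_ q)]; last by rewrite -aq ca.
  rewrite aq in ca; do 2 apply: val_inj.
  by apply: leaf_cut_uniq lz _ _ ca cq'; [apply: (valP (val q))|apply: (valP (val q'))].
rewrite -(pK x) -(pK y); apply: connect_map exy => a b /and3P[ab aS bS].
have [aI|aN] := boolP (a \in blk z :\: S0); have [bI|bN] := boolP (b \in blk z :\: S0).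
- have [[q aq] [q' bq]] := (pI a aI, pI b bI).
  rewrite aq bq !pK; apply: connect1.
  by rewrite /= /ind_adj /= /ind_adj -aq -bq.
- by rewrite (step a b) // pN.
- by rewrite (pN a) // (step b a) // adj_sym.
- by rewrite !pN.
Qed.

End Blocks.

(** * Tuples and pairs *)

Section Tuples.
Variables (k : nat).

(* Only the color of the first entry is part of the initial color of a tuple; the
   others are seen by copying the entry [i] to the front. *)
Lemma wl_equiv_col (G G' : cgraph) (v : ktuple k G) (v' : ktuple k G') i :
  wl_equiv v v' -> col (v i) = col (v' i).
Proof.
move=> Hv; have k0 : 0 < k by apply: leq_ltn_trans (ltn_ord i).
pose o : 'I_k := Ordinal k0.
have col0 (u : ktuple k G) (u' : ktuple k G') : wl_equiv u u' -> col (u o) = col (u' o).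
  move=> /(_ 0) [] /eq_in_map/(_ o) + _; rewrite mem_filter mem_enum /=.
  by move=> /(_ isT) [].
have [->|io] := eqVneq i o; first exact: col0.
have [f _ Hf] := wl_equiv_move Hv; have Hi := Hf o (v i).
have := col0 _ _ Hi; rewrite !ffunE eqxx => ->; congr col; apply/eqP.
by have [] := wl_equiv_rel o i Hi; rewrite !ffunE eqxx (negPf io) eqxx => <-.
Qed.

Lemma wl_equiv_bisim (G G' : cgraph) : wl_bisim (@wl_equiv k G G').
Proof.
move=> v v' Hv; split=> [i|i j|]; [exact: wl_equiv_col|exact: wl_equiv_rel|].
exact: wl_equiv_move.
Qed.

(** To replace entry [i] of the reindexed tuple, a free entry of [v] is used: the other indices
    occupy at most [k - 1] entries, so some [j] can hold the new vertex, and [i] is redirected to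
    [j]. *)
Lemma wl_equiv_reindex (s : 'I_k -> 'I_k) (G G' : cgraph) (v : ktuple k G)
    (v' : ktuple k G') :
  wl_equiv v v' -> wl_equiv [ffun i => v (s i)] [ffun i => v' (s i)].
Proof.
pose P (u : ktuple k G) (u' : ktuple k G') := exists v v' (s : 'I_k -> 'I_k),
  [/\ wl_equiv v v', forall i, u i = v (s i) & forall i, u' i = v' (s i)].
move=> Hv; apply: (bisim_equiv (P := P)); last first.
  by exists v, v', s; split=> // i; rewrite ffunE.
move=> u u' [{}v [{}v' [{}s [{}Hv us us']]]].
have [vc va [f bf Hf]] := wl_equiv_bisim Hv; split=> [i|i j|].
- by rewrite us us'.
- by rewrite !us !us'.
exists f => // i w.
have [j jP] : exists j, j \notin [set s l | l in [set~ i]].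
  apply/existsP; rewrite -negb_forall; apply/negP => /forallP H.
  have := leq_imset_card s [set~ i]; rewrite cardsC1 card_ord.
  have /eqP-> : [set s l | l in [set~ i]] == setT.
    by apply/eqP/setP => j; rewrite in_setT H.
  by rewrite cardsT card_ord leqNgt ltn_predL (leq_ltn_trans _ (ltn_ord i)).
have sj l : l != i -> (s l == j) = false.
  move=> li; apply: contraNF jP => /eqP <-.
  by rewrite imset_f // !inE.
exists (upd v j w), (upd v' j (f w)), (fun l => if l == i then j else s l).
split=> // l; rewrite !ffunE; case: (eqVneq l i) => [_|li]; rewrite ?eqxx ?sj //.
Qed.

(** The entries are released one by one, and the bijection of a move matches the choices for each.
    Hence a single equivalent pair of tuples makes all color counts agree. *)
Lemma equiv_card (G G' : cgraph) (v : ktuple k G) (v' : ktuple k G') r c :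
  wl_equiv v v' -> wl_count k G r c = wl_count k G' r c.
Proof.
(* The tuples of color [c] that agree with [a] from index [j] on: no constraint on the entries for
   [j = k], only [a] itself possible for [j = 0]. *)
pose P (H : cgraph) j (a u : ktuple k H) :=
  [forall i : 'I_k, (j <= i) ==> (u i == a i)] && (wl r u == c).
have PE (H : cgraph) (a : ktuple k H) : wl_count k H r c = #|P H k a|.
  apply: eq_card => u; rewrite !inE unfold_in /P; case: forallP => // -[] i.
  by rewrite leqNgt ltn_ord.
have P0 (H : cgraph) (a : ktuple k H) : #|P H 0 a| = (wl r a == c).
  have E : P H 0 a =i [pred u | (u == a) && (wl r a == c)].
    move=> u; rewrite unfold_in inE /P.
    have [->|ua] := eqVneq u a; first by case: forallP => //= -[] i; rewrite eqxx.
    apply/negbTE; rewrite negb_and -implybE; apply/implyP=> /forallP H1.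
    by case/eqP: ua; apply/ffunP => i; apply/eqP; exact: H1.
  rewrite (eq_card E); case: (wl r a == c).
    by apply: eq_trans (card1 a); apply: eq_card => u; rewrite !inE ?andbT.
  by rewrite eq_card0 // => u; rewrite !inE ?andbF.
have PS (H : cgraph) j (lj : j < k) (a : ktuple k H) :
    #|P H j.+1 a| = \sum_w #|P H j (upd a (Ordinal lj) w)|.
  rewrite -sum1_card (partition_big (fun u : ktuple k H => u (Ordinal lj)) predT) //=.
  apply: eq_bigr => w _; rewrite -sum1_card; apply: eq_bigl => u.
  rewrite !unfold_in /P andbAC; congr andb.
  apply/andP/forallP => [[/forallP Hu /eqP uw] i|Hu].
    apply/implyP; rewrite !ffunE; case: (eqVneq i (Ordinal lj)) => [->|ij ji].
      by rewrite uw.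
    have /implyP := Hu i; apply; rewrite ltn_neqAle ji andbT.
    by apply: contraNneq ij => ij; apply/eqP/val_inj.
  split; last by have /implyP/(_ (leqnn _)) := Hu (Ordinal lj); rewrite ffunE eqxx.
  apply/forallP => i; apply/implyP => ji; have /implyP/(_ (ltnW ji)) := Hu i.
  by rewrite ffunE; case: (eqVneq i (Ordinal lj)) ji => [->|//]; rewrite ltnn.
have main j : j <= k -> forall (a : ktuple k G) (a' : ktuple k G'),
    wl_equiv a a' -> #|P G j a| = #|P G' j a'|.
  elim: j => [|j IH] lj a a' Ha; first by rewrite !P0 Ha.
  have [f bf Hf] := wl_equiv_move Ha.
  rewrite !(PS _ _ lj) (reindex f) /=; last exact: onW_bij.
  by apply: eq_bigr => w _; apply: IH => //; exact: ltnW.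
by move=> Hv; rewrite (PE _ v) (PE _ v'); exact: main.
Qed.

Definition pair_tuple (G : cgraph) (x y : vert G) : ktuple k G :=
  [ffun i => if val i == 0 then x else y].

Definition pair_equiv (G G' : cgraph) (x y : vert G) (x' y' : vert G') :=
  wl_equiv (pair_tuple x y) (pair_tuple x' y').

Lemma pair_equiv_sym (G G' : cgraph) (x y : vert G) (x' y' : vert G') :
  pair_equiv x y x' y' -> pair_equiv x' y' x y.
Proof. exact: wl_equiv_sym. Qed.

Lemma equiv_pair i j (G G' : cgraph) (v : ktuple k G) (v' : ktuple k G') :
  wl_equiv v v' -> pair_equiv (v i) (v j) (v' i) (v' j).
Proof.
move/(wl_equiv_reindex (fun l => if val l == 0 then i else j)).
rewrite /pair_equiv; congr wl_equiv; apply/ffunP => l; rewrite !ffunE; by case: ifP.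
Qed.

(** Colors taken from the ambient graph let the subgraph remember how its vertices sit in [G]; for a
    stable [R] they determine their equivalence classes. *)
Definition wl_sub R (G : cgraph) (S : {set vert G}) : cgraph :=
  @CGraph (induced S) (fun x => pickle (wl R (pair_tuple (val x) (val x)))).

Definition val_tuple R (G : cgraph) (S : {set vert G}) (u : ktuple k (wl_sub R S)) :
  ktuple k G := [ffun i => val (u i : ind_vert S)].

(** A move that respects [S] and [S'] restricts to the induced subgraphs, so equivalence in the
    ambient graphs is a bisimulation between the subgraphs. *)
Lemma wl_sub_equiv R (G G' : cgraph) (S : {set vert G}) (S' : {set vert G'}) :
  (forall (v : ktuple k G) (v' : ktuple k G'), (forall i, v i \in S) ->
     (forall i, v' i \in S') -> wl_equiv v v' ->
     exists f : vert G -> vert G', [/\ bijective f,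
       forall i w, wl_equiv (upd v i w) (upd v' i (f w)) &
       forall w, (w \in S) = (f w \in S')]) ->
  forall (u : ktuple k (wl_sub R S)) (u' : ktuple k (wl_sub R S')),
    wl_equiv (val_tuple u) (val_tuple u') -> wl_equiv u u'.
Proof.
move=> Hm; apply: bisim_equiv => u u' Hu; split=> [i|i j|].
- have := equiv_pair i i Hu; rewrite !ffunE /= => H.
  by congr pickle; apply: H.
- by have [] := wl_equiv_rel i j Hu; rewrite !ffunE.
have [||f [bf Hf fS]] := Hm _ _ _ _ Hu.
- by move=> i; rewrite ffunE; exact: valP.
- by move=> i; rewrite ffunE; exact: valP.
have [g bg gE] := bij_sub bf fS.
exists g => // i w; have := Hf i (val w); congr wl_equiv; apply/ffunP => j.
  by rewrite !ffunE; case: ifP.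
by rewrite !ffunE -gE; case: ifP.
Qed.

End Tuples.

(** * Separation is determined by colors of pairs *)

Section Walks.
Variable G : graph.
Implicit Types x y c : vert G.

Fixpoint walks n x y : nat :=
  if n is m.+1 then \sum_(w | adj x w) walks m w y else x == y.

(** Walks that visit [c], organized by their first visit: from then on every continuation counts. *)
Fixpoint walks_through c n x y : nat :=
  if x == c then walks n x y
  else if n is m.+1 then \sum_(w | adj x w) walks_through c m w y else 0.

Fixpoint walks_off c n x y : nat :=
  if x == c then 0
  else if n is m.+1 then \sum_(w | adj x w) walks_off c m w y else x == y.

Lemma walks_split c n x y : walks n x y = walks_through c n x y + walks_off c n x y.
Proof.
elim: n x => [|n IH] x /=; case: (x == c); rewrite ?addn0 ?add0n //.
by rewrite -big_split; apply: eq_bigr => w _; exact: IH.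
Qed.

Lemma walks_off_linked c x y :
  reflect (exists n, 0 < walks_off c n x y) (linked_off c x y).
Proof.
apply: (iffP idP) => [/and3P[xc _ /connectP[s]]|[n]].
  elim: s x xc => [|a s IH] x xc /= => [_ ->|/andP[/and3P[xa _ ac] sP] yE].
    by exists 0; rewrite /= (negPf xc) eqxx.
  have [n Hn] := IH a ac sP yE; exists n.+1; rewrite /= (negPf xc).
  by rewrite (bigD1 a) //= addn_gt0 Hn.
elim: n x => [|n IH] x /=; have [//|xc] := eqVneq x c.
  by have [<- _|//] := eqVneq x y; exact: linked_off_refl.
rewrite lt0n sum_nat_eq0 negb_forall => /existsP[w]; rewrite negb_imply -lt0n.
case/andP=> xw /IH wy; apply: linked_off_trans (wy); apply: linked_off_adj => //.
by case/and3P: wy.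
Qed.

Lemma walks_connect x y : reflect (exists n, 0 < walks n x y) (connect (@adj G) x y).
Proof.
apply: (iffP idP) => [/connectP[s]|[n]].
  elim: s x => [|a s IH] x /= => [_ ->|/andP[xa sP] yE].
    by exists 0; rewrite /= eqxx.
  have [n Hn] := IH a sP yE; exists n.+1.
  by rewrite /= (bigD1 a) //= addn_gt0 Hn.
elim: n x => [|n IH] x /=; first by have [<- _|//] := eqVneq x y; exact: connect0.
rewrite lt0n sum_nat_eq0 negb_forall => /existsP[w]; rewrite negb_imply -lt0n.
by case/andP=> xw /IH; apply: connect_trans; exact: connect1.
Qed.

End Walks.

(** * Walks, separation, cut vertices and blocks as invariants of pair colors *)

Section Pairs.
Variables (k : nat) (k_gt1 : 1 < k).
Local Notation E := (@pair_equiv k _ _).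

Let i0 : 'I_k := Ordinal (ltnW k_gt1).
Let i1 : 'I_k := Ordinal k_gt1.

Lemma pair_equiv_rel (G G' : cgraph) (x y : vert G) (x' y' : vert G') :
  E x y x' y' -> (x == y) = (x' == y') /\ adj x y = adj x' y'.
Proof. by move/(wl_equiv_rel i0 i1); rewrite !ffunE. Qed.

Lemma pair_equiv_col (G G' : cgraph) (x y : vert G) (x' y' : vert G') :
  E x y x' y' -> col x = col x'.
Proof. by move/(wl_equiv_col i0); rewrite !ffunE. Qed.

Lemma pair_equiv_swap (G G' : cgraph) (x y : vert G) (x' y' : vert G') :
  E x y x' y' -> E y x y' x'.
Proof. by move/(equiv_pair i1 i0); rewrite !ffunE. Qed.

Lemma pair_equiv_fst (G G' : cgraph) (x y : vert G) (x' y' : vert G') :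
  E x y x' y' -> E x x x' x'.
Proof. by move/(equiv_pair i0 i0); rewrite !ffunE. Qed.

Lemma pair_equiv_snd (G G' : cgraph) (x y : vert G) (x' y' : vert G') :
  E x y x' y' -> E y y y' y'.
Proof. by move/(equiv_pair i1 i1); rewrite !ffunE. Qed.

(** The same [f] answers the replacement of either entry, so all three pairs of the triangle on [x],
    [w], [y] are matched at once. *)
Lemma pair_equiv_move (G G' : cgraph) (x y : vert G) (x' y' : vert G') :
  E x y x' y' -> exists2 f : vert G -> vert G', bijective f &
    forall w, E w y (f w) y' /\ E x w x' (f w).
Proof.
move=> /wl_equiv_move[f bf Hf]; exists f => // w; split.
  by have := equiv_pair i0 i1 (Hf i0 w); rewrite !ffunE.
by have := equiv_pair i0 i1 (Hf i1 w); rewrite !ffunE.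
Qed.

Lemma walks_equiv n (G G' : cgraph) (x y : vert G) (x' y' : vert G') :
  E x y x' y' -> walks n x y = walks n x' y'.
Proof.
elim: n x x' => [|n IH] x x' H /=; first by have [-> _] := pair_equiv_rel H.
have [f bf Hf] := pair_equiv_move H.
rewrite [RHS](reindex f) /=; last exact: onW_bij.
apply: eq_big => w; have [Hw /pair_equiv_rel[_ xw]] := Hf w; first by rewrite xw.
by move=> _; exact: IH.
Qed.

(* This is what makes separation, a ternary relation, accessible to colors of pairs:
   from its first visit of [c] on, only the pair of [c] and [y] matters for a walk,
   and before this visit only the pair of the current vertex and [c]. *)
Lemma walks_through_equiv n (G G' : cgraph) (c x y : vert G) (c' x' y' : vert G') :
  E x c x' c' -> E c y c' y' -> walks_through c n x y = walks_through c' n x' y'.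
Proof.
move=> + Hy; elim: n x x' => [|n IH] x x' H /=; have [exc _] := pair_equiv_rel H.
  rewrite -exc; case: eqP exc => [->|_] // /esym/eqP ->.
  by have [-> _] := pair_equiv_rel Hy.
rewrite -exc; case: eqP exc => [->|_] /esym; first by move/eqP->; exact: (walks_equiv n.+1 Hy).
move=> _; have [f bf Hf] := pair_equiv_move H.
rewrite [RHS](reindex f) /=; last exact: onW_bij.
apply: eq_big => w; have [Hw /pair_equiv_rel[_ xw]] := Hf w; first by rewrite xw.
by move=> _; exact: IH.
Qed.

Lemma linked_off_equiv (G G' : cgraph) (c x y : vert G) (c' x' y' : vert G') :
  E x y x' y' -> E x c x' c' -> E c y c' y' -> linked_off c x y = linked_off c' x' y'.
Proof.
move=> Hxy Hxc Hcy.
have H n : walks_off c n x y = walks_off c' n x' y'.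
  apply/eqP; rewrite -(eqn_add2l (walks_through c n x y)) -walks_split.
  by rewrite (walks_through_equiv n Hxc Hcy) -walks_split (walks_equiv n Hxy).
by apply/walks_off_linked/walks_off_linked => -[n Hn]; exists n; rewrite ?H // -H.
Qed.

Lemma connect_equiv (G G' : cgraph) (x y : vert G) (x' y' : vert G') :
  E x y x' y' -> connect (@adj G) x y = connect (@adj G') x' y'.
Proof.
move=> H; have Hn n := walks_equiv n H.
by apply/walks_connect/walks_connect => -[n Hp]; exists n; rewrite ?Hn // -Hn.
Qed.

(** The two separated neighbors are moved one after the other, so that all three pairs among the cut
    vertex and them are matched, as [linked_off_equiv] demands. *)
Lemma cutv_equiv (G G' : cgraph) (c : vert G) (c' : vert G') :
  E c c c' c' -> cutv c = cutv c'.
Proof.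
suff H (A B : cgraph) (a : vert A) (b : vert B) : E a a b b -> cutv a -> cutv b.
  by move=> Hc; apply/idP/idP; apply: H => //; exact: pair_equiv_sym.
move=> Hab /existsP[u /existsP[v /and3P[au av nuv]]].
have [f _ Hf] := pair_equiv_move Hab; have [Hua Hau] := Hf u.
have [g _ Hg] := pair_equiv_move Hua; have [Hva Huv] := Hg v.
apply/existsP; exists (f u); apply/existsP; exists (g v).
have Hav := pair_equiv_swap Hva.
have [[_ <-] [_ <-]] := (pair_equiv_rel Hau, pair_equiv_rel Hav).
by rewrite au av -(linked_off_equiv Huv Hua Hav).
Qed.

Lemma blk_equiv (G G' : cgraph) (z y : vert G) (z' y' : vert G') :
  E z y z' y' -> (y \in blk z) = (y' \in blk z').
Proof.
suff H (A B : cgraph) (a b : vert A) (a' b' : vert B) :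
    E a b a' b' -> b' \in blk a' -> b \in blk a.
  by move=> Hc; apply/idP/idP; apply: H => //; exact: pair_equiv_sym.
move=> Hab /mem_blkP[ab Hb]; apply/mem_blkP; split; first by rewrite (connect_equiv Hab).
move=> w wa wb; have [f _ /(_ w)[Hwb Haw]] := pair_equiv_move Hab.
rewrite (linked_off_equiv Hab Haw Hwb); apply: Hb.
  by rewrite eq_sym; have [<- _] := pair_equiv_rel Haw; rewrite eq_sym.
by have [<- _] := pair_equiv_rel Hwb.
Qed.

Lemma leaf_equiv (G G' : cgraph) (z : vert G) (z' : vert G') :
  E z z z' z' -> leaf z = leaf z'.
Proof.
suff H (A B : cgraph) (a : vert A) (b : vert B) : E a a b b -> leaf b -> leaf a.
  by move=> Hc; apply/idP/idP; apply: H => //; exact: pair_equiv_sym.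
move=> Hab lb; rewrite /leaf (cutv_equiv Hab) leaf_noncut //=.
apply/forall_inP=> c ca; apply/forall_inP=> d da; apply/implyP=> cc; apply/implyP=> cd.
have [f _ /(_ c)[Hca Hac]] := pair_equiv_move Hab.
have [g _ /(_ d)[Hda Hcd]] := pair_equiv_move Hca.
have [-> _] := pair_equiv_rel Hcd; apply/eqP; apply: leaf_cut_uniq lb _ _ _ _.
- by rewrite -(blk_equiv Hac).
- by rewrite -(blk_equiv (pair_equiv_swap Hda)).
- by rewrite -(cutv_equiv (pair_equiv_fst Hca)).
- by rewrite -(cutv_equiv (pair_equiv_fst Hda)).
Qed.

(** A move from [z] sends [c] to a cut vertex in the block of [z'], and there is only one. *)
Lemma attach_equiv (G G' : cgraph) (z c : vert G) (z' c' : vert G') :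
  leaf z' -> E z z z' z' -> c \in blk z -> c' \in blk z' -> cutv c -> cutv c' ->
  E z c z' c'.
Proof.
move=> lz' Hz cz cz' cc cc'; have [f _ /(_ c)[_ Hzc]] := pair_equiv_move Hz.
rewrite (leaf_cut_uniq lz' cz' _ cc' (d := f c)) //.
  by rewrite -(blk_equiv Hzc).
by rewrite -(cutv_equiv (pair_equiv_snd Hzc)).
Qed.

End Pairs.

(** * Gluing partial isomorphisms *)

(** A partition of [A], given by the class of each point, with no [e]-edge between different
    classes. *)
Definition blocks (T : finType) (cl : T -> {set T}) (e : rel T) (A : {set T}) :=
  [/\ {in A, forall x, x \in cl x /\ cl x \subset A},
      {in A, forall x y, y \in cl x -> cl y = cl x} &
      {in A &, forall x y, e x y -> y \in cl x}].

Lemma blocks_diff (T : finType) (cl : T -> {set T}) (e : rel T) (A : {set T}) x :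
  blocks cl e A -> x \in A -> blocks cl e (A :\: cl x).
Proof.
move=> [H1 H2 H3] xA; split=> [y|y|y z].
- rewrite inE => /andP[yx yA]; have [yy yS] := H1 y yA; split=> //.
  apply/subsetP => z zy; rewrite inE (subsetP yS) // andbT.
  apply: contra yx => /H2 E; rewrite -E //; rewrite (H2 _ _ _ zy) //.
- by rewrite inE => /andP[_ /H2].
by rewrite !inE => /andP[_ yA] /andP[_ zA]; exact: H3.
Qed.

Section Glue.
Variables (T T' : finType) (C : eqType) (e : rel T) (e' : rel T').
Variables (key : T -> C) (key' : T' -> C) (cl : T -> {set T}) (cl' : T' -> {set T'}).
Hypotheses (e_sym : symmetric e) (e'_sym : symmetric e').

(** The map is total and only its values on [A] matter, so partial isomorphisms can be combined by a
    case distinction. *)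
Definition iso_on (g : T -> T') (A : {set T}) (A' : {set T'}) :=
  [/\ {in A &, injective g}, g @: A = A', {in A, forall x, key' (g x) = key x} &
      {in A &, forall x y, e x y = e' (g x) (g y)}].

Lemma iso_on_glue g h (A D : {set T}) (A' D' : {set T'}) :
  D \subset A -> D' \subset A' ->
  {in D & A :\: D, forall x y, e x y = false} ->
  {in D' & A' :\: D', forall x y, e' x y = false} ->
  iso_on g D D' -> iso_on h (A :\: D) (A' :\: D') ->
  iso_on (fun x => if x \in D then g x else h x) A A'.
Proof.
move=> DA DA' eD eD' [gi gI gk ge] [hi hI hk he].
have gD x : x \in D -> g x \in D' by move=> xD; rewrite -gI imset_f.
have hD x : x \in A -> x \notin D -> h x \in A' :\: D'.
  by move=> xA xD; rewrite -hI imset_f // inE xD.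
have hN x : x \in A -> x \notin D -> h x \notin D'.
  by move=> xA /(hD _ xA); rewrite inE => /andP[].
split=> [x y xA yA|||x y xA yA].
- case: ifPn => xD; case: ifPn => yD; first exact: gi.
  + by move=> E; case/negP: (hN y yA yD); rewrite -E gD.
  + by move=> E; case/negP: (hN x xA xD); rewrite E gD.
  by apply: hi; rewrite inE ?xD ?yD.
- apply/setP => y; apply/imsetP/idP => [[x xA ->]|yA].
    case: ifPn => xD; first by rewrite (subsetP DA') ?gD.
    by have := hD x xA xD; rewrite inE => /andP[].
  have [yD|yD] := boolP (y \in D').
    move: yD; rewrite -gI => /imsetP[x xD ->]; exists x; first exact: (subsetP DA).
    by rewrite xD.
  have: y \in A' :\: D' by rewrite inE yD.
  rewrite -hI => /imsetP[x]; rewrite inE => /andP[xD xA] ->; exists x => //.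
  by rewrite (negPf xD).
- by move=> x xA /=; case: ifPn => xD; [exact: gk|apply: hk; rewrite inE xD].
case: ifPn => xD; case: ifPn => yD; first exact: ge.
- by rewrite eD ?eD' ?gD ?hD // inE yD.
- by rewrite e_sym e'_sym eD ?eD' ?gD ?hD // inE xD.
by apply: he; rewrite inE ?xD ?yD.
Qed.

(** Classes are matched greedily: equal counts supply a partner [x'] for any [x], and removing two
    classes that are isomorphic with their keys keeps the counts equal. *)
Lemma iso_on_blocks (f0 : T -> T') (A : {set T}) (A' : {set T'}) :
  blocks cl e A -> blocks cl' e' A' ->
  (forall c, #|[set x in A | key x == c]| = #|[set x in A' | key' x == c]|) ->
  {in A & A', forall x x', key x = key' x' -> exists g, iso_on g (cl x) (cl' x')} ->
  exists g, iso_on g A A'.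
Proof.
elim: {A}#|A| {-2}A (leqnn #|A|) A' => [|n IH] A lA A' bA bA' cA HA.
  have A0 : A = set0 by apply/eqP; rewrite -cards_eq0 -leqn0.
  have A'0 : A' = set0.
    apply/setP => x; rewrite inE; apply/negP => xA.
    have := cA (key' x); rewrite A0 => /esym/eqP.
    have -> : [set x0 in set0 | key x0 == key' x] = set0.
      by apply/setP => y; rewrite !inE.
    by rewrite cards0 cards_eq0 => /eqP/setP/(_ x); rewrite !inE xA eqxx.
  exists f0; split=> [x y|||x y]; rewrite A0 ?A'0 ?imset0 ?inE //.
  by move=> x; rewrite inE.
have [A0|[x xA]] := set_0Vmem A; first by apply: IH => //; rewrite A0 cards0.
have [x' x'A xx'] : exists2 x', x' \in A' & key x = key' x'.
  have : 0 < #|[set y in A' | key' y == key x]|.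
    by rewrite -cA card_gt0; apply/set0Pn; exists x; rewrite inE xA eqxx.
  by rewrite card_gt0 => /set0Pn[x']; rewrite inE => /andP[? /eqP]; exists x'.
have [g gD] := HA x x' xA x'A xx'.
have [xx xS] : x \in cl x /\ cl x \subset A by case: bA => H _ _; exact: H.
have [_ xS'] : x' \in cl' x' /\ cl' x' \subset A' by case: bA' => H _ _; exact: H.
have [h hD] : exists h, iso_on h (A :\: cl x) (A' :\: cl' x').
  apply: IH; try exact: blocks_diff.
  - rewrite -ltnS (leq_trans _ lA) //; apply: proper_card.
    by apply/properP; split; [exact: subsetDl|exists x; rewrite // inE xx].
  - move=> c; have fib (U : finType) (k : U -> C) (B D : {set U}) : D \subset B ->
        #|[set y in B :\: D | k y == c]|
        = #|[set y in B | k y == c]| - #|[set y in D | k y == c]|.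
      move=> DB; have -> : [set y in B :\: D | k y == c] = [set y in B | k y == c] :\: D.
        by apply/setP => y; rewrite !inE andbA.
      rewrite cardsD; congr (_ - #|pred_of_set _|); apply/setP => y; rewrite !inE.
      by case: (boolP (y \in D)) => [yD|]; rewrite ?andbF // (subsetP DB) // andbT.
    rewrite !fib // cA; congr (_ - _); case: gD => gi gI gk _.
    rewrite -(card_in_imset (f := g) (D := [set y in cl x | key y == c])); last first.
      by move=> y z; rewrite !inE => /andP[yx _] /andP[zx _]; exact: gi.
    apply: eq_card => y; rewrite inE -gI; apply/imsetP/andP.
      by move=> [z]; rewrite inE => /andP[zx zc] ->; rewrite imset_f // gk.
    by move=> [/imsetP[z zx ->]]; rewrite gk // => zc; exists z; rewrite // inE zx.
  - move=> y y'; rewrite !inE => /andP[_ yA] /andP[_ yA']; exact: HA.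
exists (fun y => if y \in cl x then g y else h y); apply: iso_on_glue gD hD => // y z yx.
  rewrite inE => /andP[zx zA]; apply: contraNF zx; case: bA => _ H2 H3.
  by move/(H3 y z (subsetP xS _ yx) zA); rewrite (H2 x).
rewrite inE => /andP[zx zA]; apply: contraNF zx; case: bA' => _ H2 H3.
by move/(H3 y z (subsetP xS' _ yx) zA); rewrite (H2 x').
Qed.

End Glue.

(** * Removing and restoring leaf blocks *)

Section Main.
Variables (k : nat) (k_gt1 : 1 < k).
Local Notation E := (@pair_equiv k _ _).

Let i0 : 'I_k := Ordinal (ltnW k_gt1).
Let i1 : 'I_k := Ordinal k_gt1.

Lemma val_pair_tuple R (G : cgraph) (S : {set vert G}) (x : vert (wl_sub k R S)) :
  val_tuple (pair_tuple k x x) = pair_tuple k (val (x : ind_vert S)) (val (x : ind_vert S)).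
Proof. by apply/ffunP => i; rewrite !ffunE; case: ifP. Qed.

(** An entry that is a noncut vertex makes membership in the block visible through a pair color. If
    all entries are cut vertices, they coincide, and the answer comes from a move at the pair of [z]
    and this cut vertex. *)
Lemma blk_move (G G' : cgraph) (z : vert G) (z' : vert G') :
  leaf z -> leaf z' -> E z z z' z' ->
  forall (v : ktuple k G) (v' : ktuple k G'),
    (forall i, v i \in blk z) -> (forall i, v' i \in blk z') -> wl_equiv v v' ->
    exists f : vert G -> vert G', [/\ bijective f,
      forall i w, wl_equiv (upd v i w) (upd v' i (f w)) &
      forall w, (w \in blk z) = (f w \in blk z')].
Proof.
move=> lz lz' Hz v v' vz vz' Hv.
have Hi i := equiv_pair i i Hv.
have [/existsP[i ci]|/existsPn allc] := boolP [exists i, ~~ cutv (v i)].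
  have [li Ei] := leaf_blk lz (vz i) ci.
  rewrite (cutv_equiv k_gt1 (Hi i)) in ci; have [_ Ei'] := leaf_blk lz' (vz' i) ci.
  have [f bf Hf] := wl_equiv_move Hv; exists f; split=> // w.
  (* Replacing an entry [j] other than [i] keeps the noncut vertex [v i] next to [w]. *)
  have [j ij] : exists j, i != j.
    by have [->|ii] := eqVneq i i0; [exists i1|exists i0].
  rewrite -Ei -Ei'; apply: (blk_equiv k_gt1).
  by have := equiv_pair i j (Hf j w); rewrite !ffunE eqxx (negPf ij).
have cv i : cutv (v i) by rewrite -[cutv _]negbK; exact: allc.
have cv' i : cutv (v' i) by rewrite -(cutv_equiv k_gt1 (Hi i)).
have vE i : v i = v i0 by apply: leaf_cut_uniq lz _ _ _ _.
have vE' i : v' i = v' i0 by apply: leaf_cut_uniq lz' _ _ _ _.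
have Hzc := attach_equiv k_gt1 lz' Hz (vz i0) (vz' i0) (cv i0) (cv' i0).
have [f bf Hf] := pair_equiv_move k_gt1 Hzc; exists f; split=> // [i w|w].
  have [Hw _] := Hf w.
  have := wl_equiv_reindex (fun l => if l == i then i0 else i1) Hw.
  congr wl_equiv; apply/ffunP => l; rewrite !ffunE; case: (l == i) => //=.
by have [_ Hw] := Hf w; exact: (blk_equiv k_gt1 Hw).
Qed.

Variable cls : graph -> Prop.
Hypothesis cls_her : hereditary cls.
Hypothesis cls_2conn : forall H H' : cgraph,
  cls (cbase H) -> cls (cbase H') -> kconnected 2 (cbase H) -> kconnected 2 (cbase H') ->
  ~ ciso H H' -> wl_distinguishes k H H'.

Lemma blk_ciso R (G G' : cgraph) (z : vert G) (z' : vert G') :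
  cls (cbase G) -> cls (cbase G') -> leaf z -> leaf z' -> E z z z' z' ->
  ciso (wl_sub k R (blk z)) (wl_sub k R (blk z')).
Proof.
move=> cG cG' lz lz' Hz.
have [f bf Hf] := pair_equiv_move k_gt1 Hz.
have fb w : (w \in blk z) = (f w \in blk z').
  by have [_ /(blk_equiv k_gt1)] := Hf w.
have cE := bij_card_set bf fb.
have [c2|c2] := ltnP 2 #|blk z|.
  apply: NNPP => Hn.
  have [||||r [c]] := cls_2conn _ _ _ _ Hn.
  - exact: cls_her.
  - exact: cls_her.
  - exact: leaf_blk_2connected.
  - by apply: leaf_blk_2connected; rewrite -?cE.
  (* The constant tuples at [z] and [z'] remain equivalent inside the blocks, so no color count can
     differ. *)
  case; pose x : vert (wl_sub k R (blk z)) := exist _ z (blk_refl z).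
  pose x' : vert (wl_sub k R (blk z')) := exist _ z' (blk_refl z').
  apply: (@equiv_card k _ _ (pair_tuple k x x) (pair_tuple k x' x')).
  by apply: wl_sub_equiv (blk_move lz lz' Hz) _ _ _; rewrite !val_pair_tuple.
have [g bg gE] := bij_sub bf fb; exists g; split; [exact: bg|split=> [x y|x]].
  rewrite /= /ind_adj !gE; move: (valP x) (valP y); move: (val x) (val y) => a b az bz.
  (* In a block of at most two vertices, any bijection that respects [z] and its adjacencies is an
     isomorphism. *)
  have fz : f z = z'.
    by have [_ /(pair_equiv_rel k_gt1)[+ _]] := Hf z; rewrite eqxx => /esym/eqP.
  have adjz w : adj z w = adj z' (f w) by have [_ /(pair_equiv_rel k_gt1)[]] := Hf w.
  have [->|na] := eqVneq a z; first by rewrite fz adjz.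
  have [->|nb] := eqVneq b z; first by rewrite fz adj_sym adjz adj_sym.
  have [->|ab] := eqVneq a b; first by rewrite !adj_irr.
  have /subset_leq_card : z |: [set a; b] \subset blk z.
    apply/subsetP => w; rewrite in_setU1 in_set2.
    by case/orP=> [/eqP->|/orP[]/eqP-> //]; exact: blk_refl.
  rewrite cardsU1 cards2 in_set2 [z == a]eq_sym [z == b]eq_sym (negPf na) (negPf nb) ab.
  by move/leq_trans/(_ c2).
rewrite /= gE; have [/(pair_equiv_fst k_gt1) Hx _] := Hf (val x).
by congr pickle; exact: Hx.
Qed.

(** Stability turns equal colors in the subgraphs back into equivalence in the ambient graphs.
    Outside [S] the map is filled in with [F]. *)
Lemma ciso_extend R (G G' : cgraph) (S : {set vert G}) (S' : {set vert G'})
    (F : vert G -> vert G') :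
  (forall (v : ktuple k G) (v' : ktuple k G'), wl R v = wl R v' -> wl_equiv v v') ->
  ciso (wl_sub k R S) (wl_sub k R S') ->
  exists g : vert G -> vert G', [/\ {in S &, injective g}, g @: S = S',
    {in S, forall x, E x x (g x) (g x)} & {in S &, forall x y, adj x y = adj (g x) (g y)}].
Proof.
move=> HR [h [[h' hK h'K] [hadj hcol]]].
pose g x := if insub x is Some u then val (h u) else F x.
have gE (u : ind_vert S) : g (val u) = val (h u) by rewrite /g valK.
have inS x : x \in S -> exists u : ind_vert S, x = val u by move=> xS; exists (exist _ x xS).
exists g; split=> [x y|||x y].
- move=> /inS[u ->] /inS[w ->]; rewrite !gE => /val_inj E; congr val.
  by rewrite -(hK u) E hK.
- apply/setP => y; apply/imsetP/idP => [[x /inS[u ->] ->]|yS].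
    by rewrite gE; exact: valP.
  pose u : ind_vert S' := exist _ y yS; exists (val (h' u)); first exact: valP.
  by rewrite gE h'K.
- move=> x /inS[u ->]; rewrite gE; apply: HR.
  exact: (pcan_inj (@pickleK _)) (hcol u).
by move=> /inS[u ->] /inS[w ->]; rewrite !gE; exact: hadj.
Qed.

Definition attach (G : graph) (z : vert G) := [pick c | (c \in blk z) && cutv c].

Lemma attachP (G : graph) (z c : vert G) :
  leaf z -> (attach z == Some c) = (c \in blk z) && cutv c.
Proof.
move=> lz; rewrite /attach; case: pickP => [d /andP[dz cd]|/(_ c) -> //].
apply/eqP/andP => [[<-] //|[cz cc]]; congr Some.
exact: leaf_cut_uniq lz dz cz cd cc.
Qed.

Lemma attach_none (G : graph) (z : vert G) :
  (attach z == None) = [forall c in blk z, ~~ cutv c].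
Proof.
rewrite /attach; case: pickP => [d /andP[dz cd]|H].
  by apply/esym/negbTE/forall_inP => /(_ d dz); rewrite cd.
by apply/esym/forall_inP => c cz; have := H c; rewrite cz => /= ->.
Qed.

Lemma blk_attach (G : graph) (z y : vert G) : blk z = blk y -> attach z = attach y.
Proof. by rewrite /attach => ->. Qed.

Definition leaves (G : graph) : {set vert G} := [set z | leaf z].

Lemma mem_leaves (G : graph) (z : vert G) : (z \in leaves G) = leaf z.
Proof. exact: in_set. Qed.

(** The neighbor [y] lies in the block of [x], and a noncut vertex there would be a leaf too. *)
Lemma adj_attach (G : graph) (x y : vert G) :
  leaf x -> ~~ leaf y -> adj x y -> attach x = Some y.
Proof.
move=> lx ly xy; apply/eqP; rewrite attachP // adj_blk //=.
by apply: contraR ly => cy; have [] := leaf_blk lx (adj_blk xy) cy.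
Qed.

(** * Extending an isomorphism [phi] of the trimmed graphs over the leaf blocks *)

Section Step.
Variables (R : nat) (G G' : cgraph) (F phi : vert G -> vert G').
Hypotheses (cG : cls (cbase G)) (cG' : cls (cbase G')).
Hypothesis stable : forall (v : ktuple k G) (v' : ktuple k G'),
  wl R v = wl R v' -> wl_equiv v v'.
Hypotheses (bF : bijective F) (HF : forall x, E x x (F x) (F x)).
Let K := ~: leaves G.
Let K' := ~: leaves G'.
Hypotheses (phi_inj : {in K &, injective phi}) (phi_im : phi @: K = K')
  (phi_equiv : {in K, forall x, E x x (phi x) (phi x)})
  (phi_adj : {in K &, forall x y, adj x y = adj (phi x) (phi y)}).

(** The attachment vertex, translated by [phi], forces matched leaf blocks to hang at corresponding
    cut vertices. *)
Let key (z : vert G) := (omap phi (attach z), wl R (pair_tuple k z z)).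
Let key' (z : vert G') := (attach z, wl R (pair_tuple k z z)).

Lemma phi_K x : x \in K -> phi x \in K'.
Proof. by move=> xK; rewrite -phi_im imset_f. Qed.

Lemma attach_K (H : graph) (z c : vert H) : leaf z -> attach z = Some c -> c \in ~: leaves H.
Proof.
move=> lz /eqP; rewrite attachP // => /andP[_ cc]; rewrite !inE.
by apply: contraL cc => /leaf_noncut.
Qed.

Lemma omap_attach z c : leaf z -> c \in K ->
  (omap phi (attach z) == Some (phi c)) = (attach z == Some c).
Proof.
move=> lz cK; case E : (attach z) => [d|] //=.
apply/eqP/eqP => [[/phi_inj ->]|[->]] //; exact: attach_K E.
Qed.

Lemma leaves_blocks (H : graph) :
  blocks (fun z : vert H => blk z :&: leaves H) (@adj H) (leaves H).
Proof.
split=> [z zl|z zl y|x y].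
- by rewrite inE blk_refl zl; split=> //; exact: subsetIr.
- rewrite in_setI !mem_leaves in zl *; case/andP=> yz ly.
  by have [_ ->] := leaf_blk zl yz (leaf_noncut ly).
by move=> _ yl xy; rewrite in_setI yl adj_blk.
Qed.

(** For a remaining vertex, a move from it and its image under [phi] matches the leaf vertices
    attached there color by color. For blocks without cut vertex [F] does so, since the color tells
    whether the block has one. *)
Lemma key_count c :
  #|[set z in leaves G | key z == c]| = #|[set z in leaves G' | key' z == c]|.
Proof.
case: c => [[c'|] t]; last first.
  apply: (bij_card_set bF) => x; rewrite !inE /key /key' !xpair_eqE (leaf_equiv k_gt1 (HF x)).
  have -> : wl R (pair_tuple k x x) = wl R (pair_tuple k (F x) (F x)) by exact: HF.
  congr (_ && (_ && _)); have -> : (omap phi (attach x) == None) = (attach x == None).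
    by case: (attach x).
  rewrite !attach_none; have [f [f' fK f'K] Hf] := pair_equiv_move k_gt1 (HF x).
  apply/forall_inP/forall_inP => Hc c.
    rewrite -{1}(f'K c); have [H1 H2] := Hf (f' c).
    rewrite -(blk_equiv k_gt1 H2) => /Hc.
    by rewrite (cutv_equiv k_gt1 (pair_equiv_fst k_gt1 H1)) f'K.
  have [H1 H2] := Hf c; rewrite (blk_equiv k_gt1 H2) => /Hc.
  by rewrite (cutv_equiv k_gt1 (pair_equiv_fst k_gt1 H1)).
have [|cL] := boolP (c' \in K').
  rewrite -phi_im => /imsetP[c cK ->{c'}].
  have [f bf Hf] := pair_equiv_move k_gt1 (phi_equiv cK).
  apply: (bij_card_set bf) => x; rewrite !inE /key /key' !xpair_eqE.
  have [Hxc _] := Hf x; have Hx := pair_equiv_fst k_gt1 Hxc.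
  rewrite (leaf_equiv k_gt1 Hx); have [lx|//] := boolP (leaf (f x)); rewrite !andTb.
  have -> : wl R (pair_tuple k x x) = wl R (pair_tuple k (f x) (f x)) by exact: Hx.
  congr (_ && _); have lx' : leaf x by rewrite (leaf_equiv k_gt1 Hx).
  rewrite omap_attach // !attachP // (blk_equiv k_gt1 Hxc).
  by rewrite (cutv_equiv k_gt1 (phi_equiv cK)).
(* A leaf is never an attachment vertex, so both sets are empty. *)
rewrite !eq_card0 // => x; rewrite !inE /key /key' !xpair_eqE.
  apply: contraNF cL => /andP[lx /andP[/eqP xc _]]; exact: attach_K xc.
apply: contraNF cL => /andP[lx /andP[/eqP + _]].
by case E : (attach x) => [d|] //= [<-]; apply: phi_K; exact: attach_K E.
Qed.

Lemma step_ciso : ciso G G'.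
Proof.
have [z z'|g [gi gI gk ga]] := iso_on_blocks (@adj_sym G) (@adj_sym G') F (leaves_blocks G)
    (leaves_blocks G') key_count.
  rewrite !mem_leaves => lz lz' [attE /stable Hz].
  have [g [gi gI ge ga]] := ciso_extend F stable (blk_ciso R cG cG' lz lz' Hz).
  exists g; split=> [x y|||x y].
  - by rewrite !in_setI => /andP[xz _] /andP[yz _]; exact: gi.
  - apply/setP => y; apply/imsetP/idP => [[x]|].
      rewrite in_setI mem_leaves => /andP[xz lx] ->.
      by rewrite in_setI mem_leaves -gI imset_f //= -(leaf_equiv k_gt1 (ge _ xz)).
    rewrite in_setI mem_leaves -gI => /andP[/imsetP[x xz ->]] ly.
    by exists x => //; rewrite in_setI mem_leaves xz (leaf_equiv k_gt1 (ge _ xz)).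
  - move=> x; rewrite in_setI mem_leaves => /andP[xz lx]; rewrite /key /key'; congr (_, _).
      have [_ /blk_attach->] := leaf_blk lz xz (leaf_noncut lx); rewrite attE.
      have gz : g x \in blk z' by rewrite -gI imset_f.
      have lgx : leaf (g x) by rewrite -(leaf_equiv k_gt1 (ge _ xz)).
      by have [_ /blk_attach] := leaf_blk lz' gz (leaf_noncut lgx).
    by apply/esym; exact: ge.
  by rewrite !in_setI => /andP[xz _] /andP[yz _]; exact: ga.
have {}gk x : leaf x -> key' (g x) = key x by move=> lx; apply: gk; rewrite mem_leaves.
have ge x : leaf x -> E x x (g x) (g x) by move=> /gk[_ gx]; apply: stable.
have gl x : leaf x -> leaf (g x) by move=> lx; rewrite -(leaf_equiv k_gt1 (ge x lx)).
have pl x : ~~ leaf x -> ~~ leaf (phi x).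
  by move=> lx; have := @phi_K x; rewrite !inE; apply.
have inK x : ~~ leaf x -> x \in K by rewrite !inE.
have gatt x : leaf x -> attach (g x) = omap phi (attach x).
  by move=> /gk[].
pose psi x := if leaf x then g x else phi x.
(* If [y] is the attachment vertex of [x], then [attach_equiv] matches the two pairs; otherwise
   neither side is an edge, by [adj_attach]. *)
have mixed x y : leaf x -> ~~ leaf y -> adj x y = adj (g x) (phi y).
  move=> lx ly; have H : attach x = Some y -> adj x y = adj (g x) (phi y).
    move=> xy; have gxy : attach (g x) = Some (phi y) by rewrite gatt // xy.
    move/eqP: xy; rewrite attachP // => /andP[yx cy].
    move/eqP: gxy; rewrite attachP ?gl // => /andP[yx' cy'].
    have lgx := gl x lx.
    by have [] := pair_equiv_rel k_gt1 (attach_equiv k_gt1 lgx (ge x lx) yx yx' cy cy').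
  apply/idP/idP => xy; first by rewrite -H //; apply: adj_attach.
  rewrite H //; apply/eqP; rewrite -(omap_attach lx (inK y ly)) -gatt //.
  by rewrite (adj_attach (gl x lx) (pl y ly) xy).
exists psi; split; last split.
- apply: inj_card_bij; last by rewrite (bij_eq_card bF).
  move=> x y; rewrite /psi; case: ifPn => lx; case: ifPn => ly E.
  + by apply: gi; rewrite ?inE.
  + by case/negP: (pl y ly); rewrite -E gl.
  + by case/negP: (pl x lx); rewrite E gl.
  by apply: phi_inj; rewrite ?inK.
- move=> x y; rewrite /psi; case: ifPn => lx; case: ifPn => ly.
  + by apply: ga; rewrite inE.
  + exact: mixed.
  + by rewrite adj_sym mixed // adj_sym.
  by apply: phi_adj; rewrite inK.
move=> x; rewrite /psi; case: ifPn => lx; first exact: (pair_equiv_col k_gt1 (ge x lx)).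
exact: (pair_equiv_col k_gt1 (phi_equiv (inK x lx))).
Qed.

End Step.

(** The induction applies to the graphs without leaf vertices: [leaf_exists] makes them smaller, and
    [F] restricts to them because colors determine leaves. *)
Lemma equiv_ciso (G G' : cgraph) (F : vert G -> vert G') :
  cls (cbase G) -> cls (cbase G') -> bijective F -> (forall x, E x x (F x) (F x)) ->
  ciso G G'.
Proof.
have [n] := ubnP #|vert G|; elim: n G G' F => // n IH G G' F cn cG cG' bF HF.
have [/eqP G0 | ] := boolP (#|vert G| == 0).
  by exists F; split=> //; split=> x; have := fintype0 x G0.
rewrite -lt0n => /card_gt0P[x0 _]; have [z lz] := leaf_exists x0.
have [R stable] := stable_round k G G'.
have Fl x : (x \in ~: leaves G) = (F x \in ~: leaves G').
  by rewrite !inE (leaf_equiv k_gt1 (HF x)).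
have [F1 bF1 F1E] := bij_sub bF Fl.
have IHc : ciso (wl_sub k R (~: leaves G)) (wl_sub k R (~: leaves G')).
  apply: (IH (wl_sub k R (~: leaves G)) (wl_sub k R (~: leaves G')) F1) => //;
    try exact: cls_her.
    rewrite ltnS in cn; rewrite /= card_sig; apply: leq_trans cn.
    apply: proper_card; apply/properP; split; first exact/subsetP.
    by exists z; rewrite // !inE lz.
  move=> x; apply: wl_sub_equiv; last by rewrite !val_pair_tuple F1E; exact: HF.
  move=> v v' _ _ Hv; have [f bf Hf] := wl_equiv_move Hv; exists f; split=> // w.
  have := equiv_pair i0 i0 (Hf i0 w); rewrite !ffunE eqxx !inE => Hw.
  by rewrite (leaf_equiv k_gt1 Hw).
have [phi [pi pI pe pa]] := ciso_extend F stable IHc.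
exact: (step_ciso cG cG' stable bF HF pi pI pe pa).
Qed.

(** Equal counts give a constant tuple an equivalent tuple on the other side; a single move from
    there yields the bijection of vertices that [equiv_ciso] needs. *)
Lemma indistinguishable_ciso (G G' : cgraph) :
  cls (cbase G) -> cls (cbase G') -> ~ wl_distinguishes k G G' -> ciso G G'.
Proof.
move=> cG cG' nd.
have cnt r c : wl_count k G r c = wl_count k G' r c.
  by apply: NNPP => H; apply: nd; exists r, c.
have tup (A B : cgraph) : (forall r c, wl_count k A r c = wl_count k B r c) ->
    forall x : vert A, exists x' : vert B, E x x x' x'.
  move=> H x; have [R stable] := stable_round k A B.
  have : 0 < wl_count k A R (wl R (pair_tuple k x x)).
    by apply/card_gt0P; exists (pair_tuple k x x); rewrite !inE.
  rewrite H => /card_gt0P[v']; rewrite inE => /eqP/esym/stable Hv; exists (v' i0).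
  by have := equiv_pair i0 i0 Hv; rewrite !ffunE.
have [/eqP G0 | ] := boolP (#|vert G| == 0).
  have nG (x : vert G) : False by have := fintype0 x G0.
  have nG' (x : vert G') : False.
    by have [|y _] := tup G' G _ x; [move=> r c; rewrite cnt|apply: nG y].
  exists (fun x => False_rect _ (nG x)); split; last by split=> x; case: (nG x).
  by exists (fun x => False_rect _ (nG' x)) => x; [case: (nG x)|case: (nG' x)].
rewrite -lt0n => /card_gt0P[x _]; have [x' Hx] := tup _ _ cnt x.
have [f bf Hf] := pair_equiv_move k_gt1 Hx.
apply: (equiv_ciso cG cG' bf) => w; have [Hw _] := Hf w.
exact: (pair_equiv_fst k_gt1 Hw).
Qed.

End Main.

Theorem theorem5 (cls : graph -> Prop) (k : nat) :
  graph_class cls -> hereditary cls -> 2 <= k ->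
  (forall H H' : cgraph,
      cls (cbase H) -> cls (cbase H') ->
      kconnected 2 (cbase H) -> kconnected 2 (cbase H') ->
      ~ ciso H H' -> wl_distinguishes k H H') ->
  forall G G' : graph, cls G -> cls G' -> ~ iso G G' ->
    wl_distinguishes k (mono G) (mono G').
Proof.
move=> _ her k_gt1 H2 G G' cG cG' ni; apply: NNPP => nd; apply: ni.
have [f [bf [fadj _]]] :=
  indistinguishable_ciso k_gt1 her H2 (G := mono G) (G' := mono G') cG cG' nd.
by exists f.
Qed.
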